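(* Let the loss $\ell$ satisfy: $\|\nabla \ell(\mathbf{w},z)\|\le G$ for all $\mathbf{w}\in\mathbb{R}^p$ and all examples $z$; $\ell$ is bounded below by $\ell^\star$; and $\|\nabla\ell(\mathbf{w},z)-\nabla\ell(\mathbf{w}',z)\|\le L\|\mathbf{w}-\mathbf{w}'\|$ for all $\mathbf{w},\mathbf{w}'\in\mathbb{R}^p$ and all $z$. Let $c>0$ be a fixed constant. For any integer $T>0$, run T-SGD on a training set $S$ with constant step size $\eta_t=\eta=c/\sqrt{T}$ and any cut parameter $\varepsilon$ with $0\le\varepsilon\le\min\left(1,\frac{L}{2\sqrt{T}}\right)$. Let $\mathbf{w}_J$ be sampled uniformly from the iterates $\{\mathbf{w}_1,\dots,\mathbf{w}_T\}$ produced by T-SGD. Then $$\mathbb{E}\|\nabla\mathcal{L}_S(\mathbf{w}_J)\|^2\le O\left(\frac{LG^2}{\sqrt{T}}\right),$$ where the expectation is over the randomness of T-SGD and the random draw of $\mathbf{w}_J$.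
   Context: $S=\{z_1,\dots,z_n\}$ is a dataset, $\ell(\mathbf{w},z)$ is a (possibly non-convex) differentiable loss, and $\mathcal{L}_S(\mathbf{w})=\frac1n\sum_{i=1}^n\ell(\mathbf{w},z_i)$. $\|\cdot\|$ is the Euclidean norm and $[\mathbf{v}]_i$ is the $i$-th coordinate of $\mathbf{v}$. T-SGD (Truncated SGD): starting at a given initial point $\mathbf{w}_0\in\mathbb{R}^p$, at each step $t=0,1,2,\dots$ draw, independently of the past, a mini-batch $B_t$ uniformly with replacement from $S$, compute $g(\mathbf{w}_t,B_t)=\frac1{|B_t|}\sum_{z_i\in B_t}\nabla\ell(\mathbf{w}_t,z_i)$, and set $\mathbf{w}_{t+1}=\mathbf{w}_t-\eta_t\tilde{\mathbf{g}}_t$, where $[\tilde{\mathbf{g}}_t]_i=[g(\mathbf{w}_t,B_t)]_i$ if $|[g(\mathbf{w}_t,B_t)]_i|\ge\kappa_{\varepsilon,t}$ and $[\tilde{\mathbf{g}}_t]_i=0$ otherwise. The threshold $\kappa_{\varepsilon,t}$ is determined from $\mathbf{g}=g(\mathbf{w}_t,B_t)$ and $\varepsilon\in[0,1]$ as follows: sort the squared coordinates as $[\mathbf{g}]_{(1)}^2\ge\dots\ge[\mathbf{g}]_{(p)}^2$; let $i\in\{1,\dots,p\}$ be the smallest index with $\sum_{j<i}[\mathbf{g}]_{(j)}^2\ge(1-\varepsilon^2)\|\mathbf{g}\|^2$, and put $\kappa_{\varepsilon,t}=|[\mathbf{g}]_{(i)}|$ (if no such $i$ exists, nothing is truncated,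 $\kappa_{\varepsilon,t}=0$). Consequently $\|\tilde{\mathbf{g}}_t\|^2\ge(1-\varepsilon^2)\|g(\mathbf{w}_t,B_t)\|^2$. $O(\cdot)$ refers to the dependence on $T$: the hidden constant factor does not depend on $T$ or $\varepsilon$; it may depend on $c$, on problem constants, and on the initial optimality gap $\mathcal{L}_S(\mathbf{w}_0)-\ell^\star$, which the paper treats as a constant. *)

(* Defs.v *)
From HB Require Import structures.
From mathcomp Require Import all_boot all_order all_algebra.
From mathcomp Require Import all_classical all_reals all_analysis.

Set Implicit Arguments.
Unset Strict Implicit.
Unset Printing Implicit Defensive.

Import Order.TTheory GRing.Theory Num.Theory.
Import numFieldNormedType.Exports.

Local Open Scope ring_scope.

(* MathComp-Analysis equips 'rV[R]_p with the sup norm, so the Euclidean norm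
   is defined here. Differentiability does not depend on this choice. *)
Definition enorm (R : realType) (p : nat) (v : 'rV[R]_p) : R :=
  Num.sqrt (\sum_(i < p) v ord0 i ^+ 2).

Definition gradient (R : realType) (p : nat) (f : 'rV[R]_p -> R)
    (w : 'rV[R]_p) : 'rV[R]_p :=
  \row_(i < p) 'D_(delta_mx ord0 i) f w.

Definition emp_loss (R : realType) (p n : nat) (Z : Type)
    (loss : 'rV[R]_p -> Z -> R) (S : n.-tuple Z) (w : 'rV[R]_p) : R :=
  n%:R^-1 * \sum_(i < n) loss w (tnth S i).

(* A mini-batch drawn with replacement is a tuple of indices into S; repeated
   indices count with multiplicity. *)
Definition batch_grad (R : realType) (p n m : nat) (Z : Type)
    (loss : 'rV[R]_p -> Z -> R) (S : n.-tuple Z) (w : 'rV[R]_p)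
    (B : m.-tuple 'I_n) : 'rV[R]_p :=
  m%:R^-1 *: \sum_(k < m) gradient (loss^~ (tnth S (tnth B k))) w.

Definition sorted_coords (R : realType) (p : nat) (g : 'rV[R]_p) : seq R :=
  sort (fun x y : R => y ^+ 2 <= x ^+ 2) [seq g ord0 i | i <- enum 'I_p].

(* 0-based position, in sorted_coords g, of the coordinate giving the
   threshold; its value is p when no k < p is such that the k largest squares
   add up to (1 - eps^2) |g|^2. *)
Definition cut_index (R : realType) (p : nat) (eps : R) (g : 'rV[R]_p) : nat :=
  find (fun k => (1 - eps ^+ 2) * enorm g ^+ 2 <=
                 \sum_(x <- take k (sorted_coords g)) x ^+ 2)
       (iota 0 p).

(* If cut_index is p, the default value of nth makes the threshold 0, so that
   nothing is truncated. *)
Definition threshold (R : realType) (p : nat) (eps : R) (g : 'rV[R]_p) : R :=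
  `|nth 0 (sorted_coords g) (cut_index eps g)|.

Definition truncate (R : realType) (p : nat) (eps : R) (g : 'rV[R]_p) :
    'rV[R]_p :=
  \row_(i < p) (if threshold eps g <= `|g ord0 i| then g ord0 i else 0).

(* The batches used in steps 0, ..., T - 1, the one of step t having size b t.
   The uniform law on this finite type is the law of independent batches, each
   of them made of independent uniform draws from the n examples. *)
Definition batches (n T : nat) (b : nat -> nat) :=
  {dffun forall t : 'I_T, (b t).-tuple 'I_n}.

(* The iterate w_t; only t <= T is meaningful, the sequence being constant
   after T since there are no more batches. *)
Fixpoint tsgd (R : realType) (p n T : nat) (b : nat -> nat) (Z : Type)
    (loss : 'rV[R]_p -> Z -> R) (S : n.-tuple Z) (eta : nat -> R) (eps : R)
    (w0 : 'rV[R]_p) (B : batches n T b) (t : nat) : 'rV[R]_p :=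
  if t is t'.+1 then
    let w := tsgd loss S eta eps w0 B t' in
    if insub t' is Some i then
      w - eta t' *: truncate eps (batch_grad loss S w (B i))
    else w
  else w0.

Definition unif_mean (R : realType) (Omega : finType) (X : Omega -> R) : R :=
  #|Omega|%:R^-1 * \sum_(omega : Omega) X omega.

(* Main.v *)
(* Write F for the empirical loss. It is L-smooth, the truncation error is at
   most eps * |g| by the choice of the threshold, and w_t depends only on the
   batches before step t, so that the expectation of <F'(w_t), g_t> is that of
   |F'(w_t)|^2. Each step therefore decreases F, in expectation, by
   eta * E |F'(w_t)|^2, up to eta * eps * G^2 + L * eta^2 * G^2 / 2. Summing
   over t = 0, ..., T - 1 bounds the mean over w_0, ..., w_(T-1); replacing w_0
   by w_T costs at most G^2 / T <= G^2 / sqrt T. In the degenerate cases L = 0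
   and G = 0 the bound is 0, but then all gradients vanish: an affine function
   that is bounded below is constant. *)
Require Import Defs.
From HB Require Import structures.
From mathcomp Require Import all_boot all_order all_algebra.
From mathcomp Require Import all_classical all_reals all_analysis.
From mathcomp Require Import ring lra.

Set Implicit Arguments.
Unset Strict Implicit.
Unset Printing Implicit Defensive.

Import Order.TTheory GRing.Theory Num.Theory.
Import numFieldNormedType.Exports.

Local Open Scope ring_scope.

(** * Euclidean inner product and norm *)

Definition dot (R : realType) (p : nat) (u v : 'rV[R]_p) : R :=
  \sum_(i < p) u ord0 i * v ord0 i.

Lemma dotC (R : realType) (p : nat) (u v : 'rV[R]_p) : dot u v = dot v u.
Proof. by apply: eq_bigr => i _; rewrite mulrC. Qed.

Lemma dotDr (R : realType) (p : nat) (u v w : 'rV[R]_p) :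
  dot u (v + w) = dot u v + dot u w.
Proof. by rewrite -big_split; apply: eq_bigr => i _; rewrite mxE mulrDr. Qed.

Lemma dotZr (R : realType) (p : nat) (a : R) (u v : 'rV[R]_p) :
  dot u (a *: v) = a * dot u v.
Proof. by rewrite mulr_sumr; apply: eq_bigr => i _; rewrite mxE mulrCA. Qed.

Lemma dotNr (R : realType) (p : nat) (u v : 'rV[R]_p) : dot u (- v) = - dot u v.
Proof. by rewrite -scaleN1r dotZr mulN1r. Qed.

Lemma dotBr (R : realType) (p : nat) (u v w : 'rV[R]_p) :
  dot u (v - w) = dot u v - dot u w.
Proof. by rewrite dotDr dotNr. Qed.

Lemma dot_sumr (R : realType) (p : nat) (I : finType) (u : 'rV[R]_p)
    (v : I -> 'rV[R]_p) :
  dot u (\sum_i v i) = \sum_i dot u (v i).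
Proof.
rewrite exchange_big; apply: eq_bigr => i _.
by rewrite summxE mulr_sumr.
Qed.

Lemma dot_ge0 (R : realType) (p : nat) (u : 'rV[R]_p) : 0 <= dot u u.
Proof. by apply: sumr_ge0 => i _; rewrite -expr2 sqr_ge0. Qed.

Lemma enorm_ge0 (R : realType) (p : nat) (u : 'rV[R]_p) : 0 <= enorm u.
Proof. exact: sqrtr_ge0. Qed.

Lemma enorm_sqr (R : realType) (p : nat) (u : 'rV[R]_p) :
  enorm u ^+ 2 = dot u u.
Proof.
rewrite sqr_sqrtr; last by apply: sumr_ge0 => i _; apply: sqr_ge0.
by apply: eq_bigr => i _; rewrite expr2.
Qed.

Lemma enormZ (R : realType) (p : nat) (a : R) (u : 'rV[R]_p) :
  enorm (a *: u) = `|a| * enorm u.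
Proof.
apply/eqP; rewrite -(@eqrXn2 _ 2) ?mulr_ge0 ?enorm_ge0 //.
by rewrite exprMn !enorm_sqr dotZr dotC dotZr mulrA -expr2 real_normK ?num_real.
Qed.

(** Cauchy-Schwarz: with a = |u|^2, b = |v|^2 and s = <u, v>, the square |b u - s v|^2 equals b (a b
    - s^2), and b can be divided out unless it is 0. *)
Lemma dot_le_enorm (R : realType) (p : nat) (u v : 'rV[R]_p) :
  dot u v <= enorm u * enorm v.
Proof.
apply: (le_trans (ler_norm _)).
rewrite -(@ler_pXn2r _ 2) ?nnegrE ?mulr_ge0 ?enorm_ge0 //.
rewrite exprMn real_normK ?num_real // !enorm_sqr.
set s := dot u v; set a := dot u u; set b := dot v v.
have key : 0 <= b * (a * b - s ^+ 2).
  have -> : b * (a * b - s ^+ 2) = dot (b *: u - s *: v) (b *: u - s *: v).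
    rewrite !(dotBr, dotZr) ![dot (_ - _) _]dotC !(dotBr, dotZr).
    by rewrite [dot v u]dotC -/s -/a -/b; ring.
  exact: dot_ge0.
have [b0|b0] := ltP 0 b; first by rewrite pmulr_rge0 // subr_ge0 in key.
have {}b0 : b = 0 by apply/eqP; rewrite eq_le b0 dot_ge0.
(* Now |v|^2 = 0, so every coordinate of v vanishes. *)
suff -> : s = 0 by rewrite b0 mulr0 expr0n.
rewrite /s /dot big1 // => i _.
have vv0 j : true -> 0 <= v ord0 j * v ord0 j.
  by rewrite -expr2 sqr_ge0.
have /eqP : v ord0 i * v ord0 i = 0 by exact: (psumr_eq0P vv0 b0).
by rewrite mulf_eq0 orbb => /eqP ->; rewrite mulr0.
Qed.

(** Pairing the mean u with itself gives |u|^2 <= |u| M by Cauchy-Schwarz, which avoids the triangle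
    inequality. *)
Lemma enorm_mean_le (R : realType) (p m : nat) (M : R) (v : 'I_m -> 'rV[R]_p) :
  (0 < m)%N -> (forall k, enorm (v k) <= M) ->
  enorm (m%:R^-1 *: \sum_k v k) <= M.
Proof.
move=> m0 vM; set u := _ *: _.
have [u0|u0] := ltP 0 (enorm u); last first.
  by apply: (le_trans u0); apply: le_trans (vM (Ordinal m0)); apply: enorm_ge0.
rewrite -(ler_pM2l u0) -expr2 enorm_sqr {2}/u dotZr dot_sumr mulrC.
rewrite ler_pdivrMr ?ltr0n //.
apply: (@le_trans _ _ (\sum_(k < m) enorm u * M)).
  apply: ler_sum => k _; apply: (le_trans (dot_le_enorm _ _)).
  by rewrite ler_wpM2l // enorm_ge0.
by rewrite sumr_const card_ord mulr_natr.
Qed.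

(** * Directional derivatives and the descent lemma *)

Lemma derive_gradient (R : realType) (p : nat) (f : 'rV[R]_p -> R)
    (w v : 'rV[R]_p) :
  differentiable f w -> 'D_v f w = dot (gradient f w) v.
Proof.
move=> df; rewrite deriveE // [v in 'd f w v]row_sum_delta linear_sum.
apply: eq_bigr => i _; rewrite linearZ /= mxE deriveE //.
by rewrite mulrC.
Qed.

Lemma is_derive_line (R : realType) (p : nat) (f : 'rV[R]_p -> R)
    (w v : 'rV[R]_p) (s : R) :
  differentiable f (s *: v + w) ->
  is_derive s 1 (fun t : R => f (t *: v + w))
    (dot (gradient f (s *: v + w)) v).
Proof.
move=> df; rewrite -derive_gradient //.
have E : (fun h : R => h^-1 *: (((fun t : R => f (t *: v + w)) \o shift s)
      (h *: (1 : R)) - f (s *: v + w))) =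
    (fun h : R => h^-1 *: ((f \o shift (s *: v + w)) (h *: v)
      - f (s *: v + w))).
  apply/funext => h /=; congr (_ *: (f _ - _)).
  by rewrite [_ *: 1]mulr1 scalerDl addrA.
apply: DeriveDef; last by rewrite /derive /= E.
by rewrite /derivable E; apply: diff_derivable.
Qed.

(** The mean value theorem replaces the usual integral: subtracting the linear and quadratic terms
    along the segment leaves a function [phi] with [phi 1 <= phi 0]. *)
Lemma smooth_upper_bound (R : realType) (p : nat) (L : R) (f : 'rV[R]_p -> R)
    (w v : 'rV[R]_p) :
  (forall w, differentiable f w) ->
  (forall w w', enorm (gradient f w - gradient f w') <= L * enorm (w - w')) ->
  f (w + v) <= f w + dot (gradient f w) v + L / 2 * enorm v ^+ 2.
Proof.
move=> df lip.
pose a := dot (gradient f w) v; pose b := L / 2 * enorm v ^+ 2.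
pose phi := fun t : R => f (t *: v + w) - (a * t + b * t ^+ 2).
have dphi (t : R) :
    is_derive t 1 phi (dot (gradient f (t *: v + w)) v - (a + b * (2 * t))).
  have dl := is_derive_line (df (t *: v + w)).
  have dq : is_derive t 1 (fun t : R => a * t + b * t ^+ 2) (a + b * (2 * t)).
    by apply: is_derive_eq; rewrite /GRing.scale /=; ring.
  exact: is_deriveB.
have [|s s01 Es] := @MVT_segment R phi _ 0 1 ler01 (fun t _ => dphi t).
  apply: derivable_within_continuous => t _.
  by have [] := dphi t.
have s0 : 0 <= s by rewrite (itvP s01).
have : phi 1 - phi 0 <= 0.
  rewrite Es subr0 mulr1.
  (* The derivative of [phi] at s is <f'(w + s v) - f'(w), v> - L s |v|^2, so this bound makes it
     nonpositive. *)
  have : dot (gradient f (s *: v + w) - gradient f w) v <=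
      L * enorm (s *: v) * enorm v.
    apply: (le_trans (dot_le_enorm _ _)); rewrite ler_wpM2r ?enorm_ge0 //.
    by have := lip (s *: v + w) w; rewrite addrK.
  by rewrite dotC dotBr !(dotC v) -/a enormZ ger0_norm // /b; lra.
by rewrite /phi scale1r scale0r add0r /b /a addrC [w + v]addrC; lra.
Qed.

(** * Error of the truncation *)

Lemma sum_sorted_coords (R : realType) (p : nat) (g : 'rV[R]_p) (P : pred R) :
  \sum_(x <- sorted_coords g | P x) x ^+ 2 =
  \sum_(i < p | P (g ord0 i)) g ord0 i ^+ 2.
Proof.
rewrite (@perm_big _ _ _ _ _ [seq g ord0 i | i <- enum 'I_p]).
  by rewrite big_map big_enum_cond.
by rewrite /sorted_coords perm_sort.
Qed.

(** The entries before the cut index k already reach the required level, and the threshold is the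
    entry at k in decreasing order, so all of them are kept. *)
Lemma truncate_kept (R : realType) (p : nat) (eps : R) (g : 'rV[R]_p) :
  (1 - eps ^+ 2) * enorm g ^+ 2 <=
  \sum_(i < p | threshold eps g <= `|g ord0 i|) g ord0 i ^+ 2.
Proof.
rewrite -(sum_sorted_coords g (fun x => threshold eps g <= `|x|)).
have size_s : size (sorted_coords g) = p.
  by rewrite size_sort size_map size_enum_ord.
have [kp|pk] := ltnP (cut_index eps g) p; last first.
  (* Here the default value of [nth] gives threshold 0: everything is kept, and 1 - eps^2 <= 1. *)
  rewrite /threshold nth_default ?size_s // normr0.
  rewrite (eq_bigl predT) => [|x]; last by rewrite normr_ge0.
  rewrite (sum_sorted_coords g predT) enorm_sqr.
  under eq_bigr do rewrite expr2.
  by have := dot_ge0 g; rewrite /dot; have := sqr_ge0 eps; nra.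
set k := cut_index eps g in kp *.
have cut_k : (1 - eps ^+ 2) * enorm g ^+ 2 <=
    \sum_(x <- take k (sorted_coords g)) x ^+ 2.
  pose big_prefix j := (1 - eps ^+ 2) * enorm g ^+ 2 <=
    \sum_(x <- take j (sorted_coords g)) x ^+ 2.
  have /(nth_find 0%N) : has big_prefix (iota 0 p) by rewrite has_find size_iota.
  by rewrite nth_iota.
apply: (le_trans cut_k).
rewrite -{2}(cat_take_drop k (sorted_coords g)) big_cat /=.
rewrite -[leLHS]addr0 lerD //; last by apply: sumr_ge0 => x _; apply: sqr_ge0.
rewrite [leRHS]big_mkcond big_seq [leRHS]big_seq ler_sum // => x.
move=> /(nthP 0) [j]; rewrite size_takel ?size_s ?(ltnW kp) // => jk.
rewrite nth_take // => <-; rewrite ifT // /threshold -/k.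
rewrite -(@ler_pXn2r _ 2) ?nnegrE // !real_normK ?num_real //.
pose geS := (fun x y : R => y ^+ 2 <= x ^+ 2).
apply: (@sorted_leq_nth _ geS) => //.
- by move=> y x' z; rewrite /geS => h1 h2; apply: le_trans h2 h1.
- by move=> y; apply: lexx.
- by apply: sort_sorted => y z; rewrite /geS orbC; apply: le_total.
- by rewrite inE size_s (ltn_trans jk).
- by rewrite inE size_s.
- exact: ltnW.
Qed.

(** Pythagoras: kept and discarded coordinates are disjoint, so the squared error is |g|^2 minus the
    kept part. *)
Lemma truncate_error (R : realType) (p : nat) (eps : R) (g : 'rV[R]_p) :
  0 <= eps -> enorm (g - truncate eps g) <= eps * enorm g.
Proof.
move=> eps0; rewrite -(@ler_pXn2r _ 2) ?nnegrE ?mulr_ge0 ?enorm_ge0 //.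
rewrite exprMn; have := truncate_kept eps g.
rewrite [enorm (_ - _) ^+ 2]enorm_sqr.
suff -> : dot (g - truncate eps g) (g - truncate eps g) = enorm g ^+ 2 -
    \sum_(i < p | threshold eps g <= `|g ord0 i|) g ord0 i ^+ 2 by lra.
rewrite enorm_sqr big_mkcond -sumrB; apply: eq_bigr => i _.
by rewrite !mxE; case: ifP => _; ring.
Qed.

Lemma enorm_truncate_le (R : realType) (p : nat) (eps : R) (g : 'rV[R]_p) :
  enorm (truncate eps g) <= enorm g.
Proof.
rewrite -(@ler_pXn2r _ 2) ?nnegrE ?enorm_ge0 // !enorm_sqr.
apply: ler_sum => i _; rewrite !mxE -!expr2.
by case: ifP => _; rewrite ?expr0n ?sqr_ge0.
Qed.

(** * Gradient and smoothness of the empirical loss *)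

Lemma gradient_emp_loss (R : realType) (p n : nat) (Z : Type)
    (loss : 'rV[R]_p -> Z -> R) (S : n.-tuple Z) (w : 'rV[R]_p) :
  (forall w z, differentiable (loss^~ z) w) ->
  gradient (emp_loss loss S) w =
  n%:R^-1 *: \sum_(i < n) gradient (loss^~ (tnth S i)) w.
Proof.
move=> dloss; apply/rowP => j; rewrite !mxE summxE.
have dj i : derivable (loss^~ (tnth S i)) w (delta_mx ord0 j).
  exact: diff_derivable.
have -> : emp_loss loss S = n%:R^-1 \*: (\sum_(i < n) loss^~ (tnth S i)).
  by apply/funext => x; rewrite /emp_loss fct_sumE.
rewrite deriveZ; last exact: derivable_sum.
by rewrite derive_sum //; congr (_ * _); apply: eq_bigr => i _; rewrite mxE.
Qed.

Lemma emp_loss_upper_bound (R : realType) (p n : nat) (Z : Type) (L : R)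
    (loss : 'rV[R]_p -> Z -> R) (S : n.-tuple Z) (w v : 'rV[R]_p) :
  (0 < n)%N ->
  (forall w z, differentiable (loss^~ z) w) ->
  (forall w w' z, enorm (gradient (loss^~ z) w - gradient (loss^~ z) w')
     <= L * enorm (w - w')) ->
  emp_loss loss S (w + v) <=
  emp_loss loss S w + dot (gradient (emp_loss loss S) w) v
    + L / 2 * enorm v ^+ 2.
Proof.
move=> n0 dloss lip; rewrite gradient_emp_loss // dotC dotZr dot_sumr.
have n0R : n%:R != 0 :> R by rewrite pnatr_eq0 -lt0n.
set q := L / 2 * _.
(* The quadratic term becomes an average of n copies of itself, so that the descent lemma applies
   example by example. *)
have -> : q = n%:R^-1 * \sum_(i < n) q.
  by rewrite sumr_const card_ord -[q *+ n]mulr_natl mulKf.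
rewrite /emp_loss -!mulrDr -!big_split /= ler_pM2l ?invr_gt0 ?ltr0n //.
apply: ler_sum => i _; rewrite dotC.
exact: (smooth_upper_bound w v (fun w => dloss w _) (fun w w' => lip w w' _)).
Qed.

(** * Resampling and unbiasedness of the stochastic gradients *)

(* The involution [(w, i) |-> (set w i, get w)] exchanges the component read by
   [get] with an independent uniform copy of it. *)
Lemma sum_resample (R : realType) (Omega I : finType) (get : Omega -> I)
    (set : Omega -> I -> Omega) (h : Omega -> I -> R) :
  (forall w i, get (set w i) = i) ->
  (forall w i, set (set w i) (get w) = w) ->
  (forall w i j, h (set w i) j = h w j) ->
  #|I|%:R * \sum_w h w (get w) = \sum_w \sum_i h w i.
Proof.
move=> getK setK hE.
have -> : #|I|%:R * (\sum_w h w (get w)) = \sum_w \sum_(i : I) h w (get w).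
  by rewrite mulr_sumr; apply: eq_bigr => w _; rewrite sumr_const mulr_natl.
rewrite !pair_big /=.
pose swap (x : Omega * I) := (set x.1 x.2, get x.1).
have swapK : involutive swap by case=> w i; rewrite /swap /= getK setK.
rewrite [LHS](reindex swap) /=; last by exists swap => x _; apply: swapK.
by apply: eq_bigr => -[w i] _; rewrite /= getK hE.
Qed.

(** One entry of a uniform batch is itself uniform: redraw the entry k. *)
Lemma sum_tnth (R : realType) (n m : nat) (f : 'I_n -> R) (k : 'I_m) :
  n%:R * (\sum_(B : m.-tuple 'I_n) f (tnth B k)) =
  #|{: m.-tuple 'I_n}|%:R * \sum_i f i.
Proof.
pose set (B : m.-tuple 'I_n) i := [tuple if j == k then i else tnth B j | j < m].
transitivity (\sum_(B : m.-tuple 'I_n) \sum_i f i); last first.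
  by rewrite sumr_const mulr_natl.
have := @sum_resample R _ _ (fun B => tnth B k) set (fun _ => f).
rewrite card_ord; apply => //.
- by move=> B i; rewrite tnth_mktuple eqxx.
- move=> B i; apply: eq_from_tnth => j; rewrite !tnth_mktuple.
  by case: eqP => [->|].
Qed.

(** Unbiasedness at a fixed point w, with sums in place of means: each of the m entries contributes
    equally, which cancels the factor 1/m. *)
Lemma sum_dot_batch_grad (R : realType) (p n m : nat) (Z : Type)
    (loss : 'rV[R]_p -> Z -> R) (S : n.-tuple Z) (w u : 'rV[R]_p) :
  (0 < n)%N -> (0 < m)%N ->
  (forall w z, differentiable (loss^~ z) w) ->
  \sum_(B : m.-tuple 'I_n) dot u (batch_grad loss S w B) =
  #|{: m.-tuple 'I_n}|%:R * dot u (gradient (emp_loss loss S) w).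
Proof.
move=> n0 m0 dloss; rewrite gradient_emp_loss // dotZr dot_sumr.
under eq_bigr do rewrite dotZr dot_sumr.
rewrite -mulr_sumr exchange_big /=.
have n0R : n%:R != 0 :> R by rewrite pnatr_eq0 -lt0n.
have m0R : m%:R != 0 :> R by rewrite pnatr_eq0 -lt0n.
pose f i := dot u (gradient (loss^~ (tnth S i)) w).
have Ef k : \sum_(B : m.-tuple 'I_n) f (tnth B k) =
    n%:R^-1 * (#|{: m.-tuple 'I_n}|%:R * \sum_i f i).
  by rewrite -(sum_tnth f k) mulKf.
rewrite (eq_bigr _ (fun k _ => Ef k)).
rewrite sumr_const card_ord -[X in _ * X]mulr_natl mulKf // /f; ring.
Qed.

(** The type of a batch depends on t through its size, hence a dependent update; it serves as the
    [set] of [sum_resample]. *)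
Definition set_batch (n T : nat) (b : nat -> nat) (B : batches n T b)
    (t : 'I_T) (x : (b t).-tuple 'I_n) : batches n T b :=
  finfun (eqtype.dfwith (fun s : 'I_T => B s) x).

Lemma set_batch_in (n T : nat) (b : nat -> nat) (B : batches n T b)
    (t : 'I_T) (x : (b t).-tuple 'I_n) :
  set_batch B x t = x.
Proof. by rewrite ffunE dfwith_in. Qed.

Lemma set_batch_out (n T : nat) (b : nat -> nat) (B : batches n T b)
    (t s : 'I_T) (x : (b t).-tuple 'I_n) :
  t != s -> set_batch B x s = B s.
Proof. by move=> ts; rewrite ffunE dfwith_out. Qed.

Lemma set_batchK (n T : nat) (b : nat -> nat) (B : batches n T b)
    (t : 'I_T) (x : (b t).-tuple 'I_n) :
  set_batch (set_batch B x) (B t) = B.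
Proof.
apply/ffunP => s; have [<-|ts] := eqVneq t s; first by rewrite set_batch_in.
by rewrite !set_batch_out.
Qed.

Lemma tsgdS (R : realType) (p n T : nat) (b : nat -> nat) (Z : Type)
    (loss : 'rV[R]_p -> Z -> R) (S : n.-tuple Z) (eta : nat -> R) (eps : R)
    (w0 : 'rV[R]_p) (B : batches n T b) (t : 'I_T) :
  let w := tsgd loss S eta eps w0 B in
  w t.+1 = w t - eta t *: truncate eps (batch_grad loss S (w t) (B t)).
Proof. by rewrite /= valK. Qed.

(** The iterate k reads only batches of index below k. This is the independence of w_t from the
    batch of step t. *)
Lemma tsgd_set_batch (R : realType) (p n T : nat) (b : nat -> nat) (Z : Type)
    (loss : 'rV[R]_p -> Z -> R) (S : n.-tuple Z) (eta : nat -> R) (eps : R)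
    (w0 : 'rV[R]_p) (B : batches n T b) (t : 'I_T) (x : (b t).-tuple 'I_n)
    (k : nat) :
  (k <= t)%N ->
  tsgd loss S eta eps w0 (set_batch B x) k = tsgd loss S eta eps w0 B k.
Proof.
elim: k => [//|k IHk] kt; cbn [tsgd]; rewrite (IHk (ltnW kt)).
case: (insubP _ k) => [i _ ik|//].
rewrite set_batch_out //.
by apply/eqP => ti; rewrite ti -ik ltnn in kt.
Qed.

(** Resampling the batch of step t leaves w_t fixed, so unbiasedness applies to the fresh batch
    conditionally on w_t. *)
Lemma sum_dot_stochastic_grad (R : realType) (p n T : nat) (b : nat -> nat)
    (Z : Type) (loss : 'rV[R]_p -> Z -> R) (S : n.-tuple Z) (eta : nat -> R)
    (eps : R) (w0 : 'rV[R]_p) (t : 'I_T) :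
  (0 < n)%N -> (0 < b t)%N ->
  (forall w z, differentiable (loss^~ z) w) ->
  let w (B : batches n T b) := tsgd loss S eta eps w0 B t in
  let dF := gradient (emp_loss loss S) in
  \sum_B dot (dF (w B)) (batch_grad loss S (w B) (B t)) =
  \sum_B enorm (dF (w B)) ^+ 2.
Proof.
move=> n0 b0 dloss w dF.
have I0 : #|{: (b t).-tuple 'I_n}|%:R != 0 :> R.
  by rewrite pnatr_eq0 card_tuple card_ord -lt0n expn_gt0 n0.
apply: (mulfI I0).
rewrite (@sum_resample _ _ _ (fun B : batches n T b => B t)
  (fun B x => set_batch B x)
  (fun B x => dot (dF (w B)) (batch_grad loss S (w B) x))).
- rewrite mulr_sumr; apply: eq_bigr => B _.
  by rewrite sum_dot_batch_grad // enorm_sqr.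
- by move=> B x; apply: set_batch_in.
- by move=> B x; apply: set_batchK.
- by move=> B x y; rewrite /w tsgd_set_batch.
Qed.

(** * Descent of the empirical loss along the iterates *)

Lemma enorm_gradient_emp_loss_le (R : realType) (p n : nat) (Z : Type) (G : R)
    (loss : 'rV[R]_p -> Z -> R) (S : n.-tuple Z) (w : 'rV[R]_p) :
  (0 < n)%N ->
  (forall w z, differentiable (loss^~ z) w) ->
  (forall w z, enorm (gradient (loss^~ z) w) <= G) ->
  enorm (gradient (emp_loss loss S) w) <= G.
Proof.
by move=> n0 dloss lossG; rewrite gradient_emp_loss //; apply: enorm_mean_le.
Qed.

Lemma truncated_step_descent (R : realType) (p n m : nat) (Z : Type)
    (G L eta eps : R) (loss : 'rV[R]_p -> Z -> R) (S : n.-tuple Z)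
    (w : 'rV[R]_p) (B : m.-tuple 'I_n) :
  (0 < n)%N -> (0 < m)%N -> 0 <= L -> 0 <= eta -> 0 <= eps ->
  (forall w z, differentiable (loss^~ z) w) ->
  (forall w z, enorm (gradient (loss^~ z) w) <= G) ->
  (forall w w' z, enorm (gradient (loss^~ z) w - gradient (loss^~ z) w')
     <= L * enorm (w - w')) ->
  let F := emp_loss loss S in
  let g := batch_grad loss S w B in
  F (w - eta *: truncate eps g) <=
  F w - eta * dot (gradient F w) g
    + (eta * eps * G ^+ 2 + L / 2 * eta ^+ 2 * G ^+ 2).
Proof.
move=> n0 m0 L0 eta0 eps0 dloss lossG lip /=.
set F := emp_loss loss S; set g := batch_grad loss S w B.
have FG : enorm (gradient F w) <= G by apply: enorm_gradient_emp_loss_le.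
have G0 : 0 <= G by apply: le_trans FG; apply: enorm_ge0.
have gG : enorm g <= G by apply: enorm_mean_le.
apply: (le_trans (emp_loss_upper_bound _ _ _ n0 dloss lip)).
rewrite -/F dotNr dotZr -addrA -[leRHS]addrA lerD2l.
(* Splitting off the discarded part isolates the term whose expectation is known; the rest costs at
   most eps * G^2 by Cauchy-Schwarz. *)
have -> : dot (gradient F w) (truncate eps g) =
    dot (gradient F w) g - dot (gradient F w) (g - truncate eps g).
  by rewrite dotBr; ring.
have dot_err : dot (gradient F w) (g - truncate eps g) <= eps * G ^+ 2.
  apply: (le_trans (dot_le_enorm _ _)).
  have -> : eps * G ^+ 2 = G * (eps * G) by ring.
  apply: ler_pM; rewrite ?enorm_ge0 //.
  by apply: (le_trans (truncate_error _ eps0)); rewrite ler_wpM2l.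
have sqr_le : enorm (- (eta *: truncate eps g)) ^+ 2 <= eta ^+ 2 * G ^+ 2.
  rewrite -scaleNr enormZ normrN ger0_norm // exprMn ler_wpM2l ?sqr_ge0 //.
  rewrite ler_pXn2r ?nnegrE ?enorm_ge0 //.
  exact: le_trans (enorm_truncate_le _ _) gG.
have h1 : eta * dot (gradient F w) (g - truncate eps g) <= eta * (eps * G ^+ 2).
  by rewrite ler_wpM2l.
have h2 : L / 2 * enorm (- (eta *: truncate eps g)) ^+ 2 <=
    L / 2 * (eta ^+ 2 * G ^+ 2).
  by rewrite ler_wpM2l // divr_ge0.
by move: h1 h2; rewrite mulrBr; lra.
Qed.

Lemma card_batches_gt0 (n T : nat) (b : nat -> nat) :
  (0 < n)%N -> (0 < #|{: batches n T b}|)%N.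
Proof.
move=> n0; apply/card_gt0P.
by exists (finfun (fun t : 'I_T => nseq_tuple (b t) (Ordinal n0))).
Qed.

Lemma sum_sqr_gradient_le (R : realType) (p n T : nat) (b : nat -> nat)
    (Z : Type) (G L eta eps lstar : R) (loss : 'rV[R]_p -> Z -> R)
    (S : n.-tuple Z) (w0 : 'rV[R]_p) :
  (0 < n)%N -> (forall t, (0 < b t)%N) -> 0 <= L -> 0 <= eta -> 0 <= eps ->
  (forall w z, differentiable (loss^~ z) w) ->
  (forall w z, enorm (gradient (loss^~ z) w) <= G) ->
  (forall w z, lstar <= loss w z) ->
  (forall w w' z, enorm (gradient (loss^~ z) w - gradient (loss^~ z) w')
     <= L * enorm (w - w')) ->
  let F := emp_loss loss S in
  let w (B : batches n T b) := tsgd loss S (fun=> eta) eps w0 B in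
  eta * (\sum_(t < T) \sum_B enorm (gradient F (w B t)) ^+ 2) <=
  #|{: batches n T b}|%:R * (F w0 - lstar
    + T%:R * (eta * eps * G ^+ 2 + L / 2 * eta ^+ 2 * G ^+ 2)).
Proof.
move=> n0 b0 L0 eta0 eps0 dloss lossG loss_ge lip /=.
set F := emp_loss loss S.
pose w (B : batches n T b) := tsgd loss S (fun=> eta) eps w0 B.
set N := _%:R; set q := _ + L / 2 * _ * _.
pose d t := \sum_B enorm (gradient F (w B t)) ^+ 2.
pose a t := \sum_B F (w B t).
(* [a t] and [d t] are N times the expected loss and the expected squared gradient norm at w_t, N
   being the number of batch sequences. *)
have step (t : 'I_T) : a t.+1 <= a t - eta * d t + N * q.
  rewrite /d -sum_dot_stochastic_grad // mulr_sumr.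
  have -> : N * q = \sum_(B : batches n T b) q by rewrite sumr_const mulr_natl.
  rewrite -sumrB -big_split /=; apply: ler_sum => B _.
  by rewrite /w tsgdS; apply: truncated_step_descent.
have telescope k : (k <= T)%N ->
    a k + eta * (\sum_(t < k) d t) <= a 0%N + k%:R * (N * q).
  elim: k => [|k IHk] kT; first by rewrite big_ord0; lra.
  rewrite big_ord_recr /= -natr1.
  by have := IHk (ltnW kT); have := step (Ordinal kT) => /=; lra.
have a0 : a 0%N = N * F w0 by rewrite /a /w /= sumr_const mulr_natl.
have aT : N * lstar <= a T.
  rewrite mulr_natl -sumr_const; apply: ler_sum => B _.
  rewrite /F /emp_loss mulrC ler_pdivlMr ?ltr0n //.
  by rewrite mulr_natr -[n in _ *+ n]card_ord -sumr_const; apply: ler_sum.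
by have := telescope T (leqnn _); rewrite a0 -/N; lra.
Qed.

(** * The degenerate case and the final rate *)

Lemma gradient_eq0_of_lipschitz0 (R : realType) (p : nat) (m : R)
    (f : 'rV[R]_p -> R) (w : 'rV[R]_p) :
  (forall w, differentiable f w) ->
  (forall w, m <= f w) ->
  (forall w w', enorm (gradient f w - gradient f w') <= 0 * enorm (w - w')) ->
  enorm (gradient f w) = 0.
Proof.
move=> df fm lip; apply/eqP; rewrite -sqrf_eq0 eq_le sqr_ge0 andbT leNgt.
apply/negP => g0; set g := enorm _ ^+ 2 in g0.
(* With L = 0 the descent lemma has no quadratic term, and this step length brings its upper bound
   down to m - 1. *)
pose s := (f w - m + 1) / g.
have := smooth_upper_bound w (- s *: gradient f w) df lip.
rewrite dotZr -enorm_sqr -/g !mul0r addr0 mulNr divfK ?gt_eqF //.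
by have := fm (w + - s *: gradient f w); lra.
Qed.

Lemma unif_mean_sum (R : realType) (Omega : finType) (T : nat)
    (f : Omega -> 'I_T -> R) :
  unif_mean (fun x : Omega * 'I_T => f x.1 x.2) =
  (#|Omega|%:R * T%:R)^-1 * \sum_t \sum_w f w t.
Proof.
by rewrite /unif_mean card_prod card_ord natrM exchange_big pair_big.
Qed.

Theorem theorem2 (R : realType) :
  exists C : R -> R -> R -> R -> R,
  forall (c G L lstar : R) (p n : nat) (Z : Type)
    (loss : 'rV[R]_p -> Z -> R) (S : n.-tuple Z) (w0 : 'rV[R]_p),
    0 < c ->
    (0 < n)%N ->
    (forall (w : 'rV[R]_p) (z : Z), differentiable (loss^~ z) w) ->
    (forall (w : 'rV[R]_p) (z : Z), enorm (gradient (loss^~ z) w) <= G) ->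
    (forall (w : 'rV[R]_p) (z : Z), lstar <= loss w z) ->
    (forall (w w' : 'rV[R]_p) (z : Z),
       enorm (gradient (loss^~ z) w - gradient (loss^~ z) w')
       <= L * enorm (w - w')) ->
  forall (b : nat -> nat) (T : nat) (eps : R),
    (forall t : nat, (0 < b t)%N) ->
    (0 < T)%N ->
    0 <= eps <= Num.min 1 (L / (2 * Num.sqrt T%:R)) ->
    unif_mean (fun omega : batches n T b * 'I_T =>
      enorm (gradient (emp_loss loss S)
        (tsgd loss S (fun _ => c / Num.sqrt T%:R) eps w0 omega.1
              (omega.2).+1)) ^+ 2)
    <= C c L G (emp_loss loss S w0 - lstar) * (L * G ^+ 2 / Num.sqrt T%:R).
Proof.
(* The coefficients of 1 / sqrt T: initial gap, truncation error, quadratic term, and replacement of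
   w_0 by w_T. The quotient by L G^2 below gives the required form when L G^2 is nonzero. *)
pose K c L G D : R := D / c + L * G ^+ 2 / 2 + L * c * G ^+ 2 / 2 + G ^+ 2.
exists (fun c L G D => K c L G D / (L * G ^+ 2)).
move=> c G L lstar p n Z loss S w0 c0 n0 dloss lossG loss_ge lip b T eps b0 T0.
rewrite le_min => /andP[eps0 /andP[_ epsL]].
set r := Num.sqrt T%:R in epsL *.
have r0 : 0 < r by rewrite sqrtr_gt0 ltr0n.
have r2 : r ^+ 2 = T%:R by rewrite sqr_sqrtr.
have r1 : 1 <= r.
  by rewrite -(@ler_pXn2r _ 2) ?nnegrE ?(ltW r0) // expr1n r2 ler1n.
(* The sign of L follows from 0 <= eps <= L / (2 r). *)
have L0 : 0 <= L.
  by move: (le_trans eps0 epsL); rewrite pmulr_lge0 // invr_gt0 mulr_gt0.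
set F := emp_loss loss S; set eta := c / r.
have [LG0|LG0] := eqVneq (L * G ^+ 2) 0.
  have gF0 w : enorm (gradient F w) = 0.
    apply/eqP; rewrite eq_le enorm_ge0 andbT.
    have /orP[/eqP L00|G00] : (L == 0) || (G ^+ 2 == 0) by rewrite -mulf_eq0 LG0.
      (* The bound on the mean is used with 0 in place of G. *)
      apply: enorm_gradient_emp_loss_le => // {}w z.
      rewrite L00 in lip.
      by rewrite (@gradient_eq0_of_lipschitz0 _ _ lstar).
    rewrite sqrf_eq0 in G00; rewrite -(eqP G00).
    exact: enorm_gradient_emp_loss_le.
  rewrite LG0 !mul0r mulr0 /unif_mean big1 ?mulr0 // => x _.
  by rewrite gF0 expr0n.
set D := F w0 - lstar.
have -> : K c L G D / (L * G ^+ 2) * (L * G ^+ 2 / r) = K c L G D / r.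
  by rewrite mulrA divfK.
pose w (B : batches n T b) := tsgd loss S (fun=> eta) eps w0 B.
pose d t := \sum_B enorm (gradient F (w B t)) ^+ 2.
rewrite (@unif_mean_sum _ _ _
  (fun B (t : 'I_T) => enorm (gradient F (w B t.+1)) ^+ 2)).
set N := _%:R; rewrite -[X in _ * X]/(\sum_(t < T) d t.+1).
have N0 : 0 < N by rewrite ltr0n card_batches_gt0.
have eta0 : 0 < eta by rewrite divr_gt0.
have := @sum_sqr_gradient_le R p n T b Z G L eta eps lstar loss S w0 n0 b0 L0
  (ltW eta0) eps0 dloss lossG loss_ge lip.
rewrite /= -/F -/D -/N -[X in eta * X]/(\sum_(t < T) d t) => main.
(* The sampled iterates are w_1, ..., w_T, while the descent controls w_0, ..., w_(T-1). *)
have shift : \sum_(t < T) d t.+1 <= \sum_(t < T) d t + N * G ^+ 2.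
  have dT : d T <= N * G ^+ 2.
    rewrite mulr_natl -sumr_const; apply: ler_sum => B _.
    have FG := enorm_gradient_emp_loss_le S (w B T) n0 dloss lossG.
    by rewrite ler_pXn2r ?nnegrE ?enorm_ge0 // (le_trans (enorm_ge0 _) FG).
  have d0 : 0 <= d 0%N by apply: sumr_ge0 => B _; apply: sqr_ge0.
  rewrite -(lerD2l (d 0%N)) -(big_ord_recl T (fun t => d t)) big_ord_recr /=.
  by apply: (le_trans (lerD (lexx _) dT)); rewrite lerDr.
rewrite mulrC ler_pdivrMr ?(mulr_gt0 N0) ?ltr0n //; apply: (le_trans shift).
rewrite -r2 in main *.
have main' : \sum_(t < T) d t <= N * (D + r ^+ 2 *
    (eta * eps * G ^+ 2 + L / 2 * eta ^+ 2 * G ^+ 2)) / eta.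
  by rewrite ler_pdivlMr // mulrC.
apply: (le_trans (lerD main' (lexx _))).
have -> : N * (D + r ^+ 2 * (eta * eps * G ^+ 2 + L / 2 * eta ^+ 2 * G ^+ 2))
      / eta + N * G ^+ 2 =
    N * (r * (D / c) + r ^+ 2 * eps * G ^+ 2 + r * (L * c * G ^+ 2 / 2) + G ^+ 2).
  by rewrite /eta; field; rewrite !gt_eqF.
have -> : K c L G D / r * (N * r ^+ 2) = N * (r * K c L G D).
  by field; rewrite gt_eqF.
rewrite ler_pM2l //.
(* The upper bound on eps turns the factor T = r^2 of the truncation error into r. *)
have epsr : r ^+ 2 * eps * G ^+ 2 <= r * (L * G ^+ 2 / 2).
  have -> : r * (L * G ^+ 2 / 2) = r ^+ 2 * (L / (2 * r)) * G ^+ 2.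
    by field; rewrite gt_eqF.
  by rewrite ler_wpM2r ?sqr_ge0 // ler_wpM2l ?sqr_ge0.
have G2 : G ^+ 2 <= r * G ^+ 2 by rewrite ler_peMl ?sqr_ge0.
by rewrite /K; lra.
Qed.
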